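(* Let $d\in\mathbb{N}$. Then there exist numbers $0<c_d<C_d$, depending only on $d$, with the following property: for every integration lattice $L\subseteq\mathbb{R}^d$ with lattice point set $\mathcal{P}(L)$ in $[0,1)^d$, and for every $\gamma\in(0,\infty]$, $$\frac{c_d}{2^{1/\gamma}}\,\sigma(L)\le\big\|\mathrm{dist}(\cdot,\mathcal{P}(L))\big\|_{L_\gamma([0,1)^d)}\le C_d\,\sigma(L).$$
   Context: An integration lattice $L$ in $\mathbb{R}^d$ is a discrete additive subgroup of $\mathbb{R}^d$ containing $\mathbb{Z}^d$. Its lattice point set is the finite set $\mathcal{P}(L):=L\cap[0,1)^d$. The spectral test $\sigma(L)$ is the largest distance between adjacent hyperplanes, taken over all families of parallel hyperplanes that cover $L$. Equivalently, $\sigma(L)=1/\min\{\|\boldsymbol{h}\|_2 : \boldsymbol{h}\in L^{\perp}\setminus\{\boldsymbol{0}\}\}$, where $L^{\perp}:=\{\boldsymbol{h}\in\mathbb{R}^d : \boldsymbol{h}\cdot\boldsymbol{x}\in\mathbb{Z}\text{ for all }\boldsymbol{x}\in L\}$ and $\|\cdot\|_2$ is the Euclidean norm. For $\boldsymbol{x}\in\mathbb{R}^d$ and $A\subseteq\mathbb{R}^d$, $\mathrm{dist}(\boldsymbol{x},A):=\inf_{\boldsymbol{y}\in A}\|\boldsymbol{x}-\boldsymbol{y}\|_2$. For $\gamma\in(0,\infty)$, $\|g\|_{L_\gamma([0,1)^d)}:=\big(\int_{[0,1)^d}|g(\boldsymbol{x})|^\gamma\,d\boldsymbol{x}\big)^{1/\gamma}$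 (only a quasi-norm for $\gamma<1$). For $\gamma=\infty$, $\|\mathrm{dist}(\cdot,\mathcal{P}(L))\|_{L_\infty([0,1)^d)}=\sup_{\boldsymbol{y}\in[0,1)^d}\min_{\boldsymbol{x}\in\mathcal{P}(L)}\|\boldsymbol{x}-\boldsymbol{y}\|_2$, and $1/\gamma=0$. *)

(* Defs.v *)
From HB Require Import structures.
From mathcomp Require Import all_boot all_order all_algebra.
From mathcomp Require Import all_classical all_reals all_analysis.

Set Implicit Arguments.
Unset Strict Implicit.
Unset Printing Implicit Defensive.
Import Order.TTheory GRing.Theory Num.Theory.
Import numFieldNormedType.Exports.

Local Open Scope classical_set_scope.
Local Open Scope ring_scope.

(* MathComp-Analysis has the sigma-algebra generated by the coordinates on
   n.-tuple T, but no n-fold product measure.  The Lebesgue measure on n-tuples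
   of reals is built by recursion on n: it is the image under consing of the
   binary product measure; lebesgue_tuple_box computes it on boxes. *)
Section cons_measure.
Context (R : realType) (n : nat).
Local Notation RT := (measurableTypeR R).
Variable mu : {sigma_finite_measure set (n.-tuple RT) -> \bar R}.

Definition cons_pair (p : RT * n.-tuple RT) : n.+1.-tuple RT :=
  [the n.+1.-tuple RT of p.1 :: p.2].

Lemma measurable_cons_pair : measurable_fun [set: RT * n.-tuple RT] cons_pair.
Proof. exact: measurable_cons. Qed.

Definition cons_measure : set (n.+1.-tuple RT) -> \bar R :=
  pushforward (@lebesgue_measure R \x mu)%E cons_pair.

Let cons_measure0 : cons_measure set0 = 0%E.
Proof. by rewrite /cons_measure /pushforward preimage_set0 measure0. Qed.

Let cons_measure_ge0 A : (0 <= cons_measure A)%E.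
Proof. by rewrite /cons_measure /pushforward measure_ge0. Qed.

Let cons_measure_sigma_additive : semi_sigma_additive cons_measure.
Proof.
move=> F mF tF mUF; rewrite /cons_measure /pushforward preimage_bigcup.
apply: measure_semi_sigma_additive.
- by move=> k; rewrite -[X in measurable X]setTI; exact: measurable_cons_pair.
- apply/trivIsetP => /= i j _ _ ij; rewrite -preimage_setI.
  by move/trivIsetP : tF => /(_ _ _ _ _ ij) ->//; rewrite preimage_set0.
- by rewrite -preimage_bigcup -[X in measurable X]setTI;
    exact: measurable_cons_pair.
Qed.

HB.instance Definition _ := isMeasure.Build _ _ _ cons_measure
  cons_measure0 cons_measure_ge0 cons_measure_sigma_additive.

Let split_tuple (t : n.+1.-tuple RT) : RT * n.-tuple RT :=
  (thead t, [tuple of behead t]).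

Let measurable_split_tuple : measurable_fun [set: n.+1.-tuple RT] split_tuple.
Proof.
by apply/measurable_fun_pairP; split;
  [exact: measurable_tnth | exact: measurable_behead].
Qed.

Let cons_pairK : cancel cons_pair split_tuple.
Proof. by case=> x t; congr pair; exact/val_inj. Qed.

Let cons_measure_sigma_finite : sigma_finite setT cons_measure.
Proof.
have /sigma_finiteP[F [FT ndF Foo]] := sigma_finiteT (@lebesgue_measure R).
have /sigma_finiteP[G [GT ndG Goo]] := sigma_finiteT mu.
exists (fun k => split_tuple @^-1` (F k `*` G k)).
  rewrite -preimage_bigcup; apply/esym/seteqP; split => // t _ /=.
  have [i _ Fi] : (\bigcup_k F k) (split_tuple t).1 by rewrite -FT.
  have [j _ Gj] : (\bigcup_k G k) (split_tuple t).2 by rewrite -GT.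
  exists (maxn i j) => //; split.
  - by move: Fi; apply/subsetPset/ndF/leq_maxl.
  - by move: Gj; apply/subsetPset/ndG/leq_maxr.
move=> k; have [mF Fk] := Foo k; have [mG Gk] := Goo k; split.
  rewrite -[X in measurable X]setTI; apply: measurable_split_tuple => //.
  exact: measurableX.
rewrite /cons_measure /pushforward -comp_preimage.
rewrite (_ : split_tuple \o cons_pair = id); last exact/funext/cons_pairK.
by rewrite preimage_id product_measure1E// lte_mul_pinfty// ge0_fin_numE.
Qed.

HB.instance Definition _ := Measure_isSigmaFinite.Build _ _ _ cons_measure
  cons_measure_sigma_finite.

Definition cons_sfmeasure :
  {sigma_finite_measure set (n.+1.-tuple RT) -> \bar R} := cons_measure.

End cons_measure.

Fixpoint lebesgue_tuple (R : realType) (n : nat) :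
    {sigma_finite_measure set (n.-tuple (measurableTypeR R)) -> \bar R} :=
  match n with
  | 0 => \d_[tuple]
  | m.+1 => cons_sfmeasure (lebesgue_tuple R m)
  end.

Lemma measurable_tuple_box (R : realType) (n : nat)
    (A : 'I_n -> set (measurableTypeR R)) : (forall i, measurable (A i)) ->
  measurable [set t : n.-tuple (measurableTypeR R) | forall i, A i (tnth t i)].
Proof.
move=> mA; rewrite (_ : [set t | _] =
    \big[setI/setT]_(i < n) (@tnth n (measurableTypeR R) ^~ i @^-1` A i)).
  apply: bigsetI_measurable => i _.
  by rewrite -[X in measurable X]setTI; exact: measurable_tnth.
apply/seteqP; split=> t; last first.
  by rewrite -bigcap_seq => + i; apply; exact: mem_index_enum.
by rewrite -bigcap_seq => At i _; exact: At.
Qed.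

Lemma lebesgue_tuple_box (R : realType) (n : nat)
    (A : 'I_n -> set (measurableTypeR R)) : (forall i, measurable (A i)) ->
  lebesgue_tuple R n [set t | forall i, A i (tnth t i)]
  = (\prod_(i < n) lebesgue_measure (A i))%E.
Proof.
elim: n A => [A _|n IHn A mA].
  by rewrite big_ord0 /= diracE mem_set // => -[].
have mB := measurable_tuple_box (fun i => mA (lift ord0 i)).
rewrite big_ord_recl -(IHn (fun i => A (lift ord0 i))) //.
rewrite -(product_measure1E lebesgue_measure (lebesgue_tuple R n)) //.
congr product_measure1; apply/seteqP; split=> -[x t] /=.
  move=> At; split=> [|i]; first exact: (At ord0).
  by have := At (lift ord0 i); rewrite tnthS.
by move=> [Ax At] i; case: (unliftP ord0 i) => [j|] -> //; rewrite tnthS.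
Qed.

Section lattices.
Context (R : realType) (d : nat).
Implicit Types (x y u : 'rV[R]_d) (A L : set 'rV[R]_d) (g : 'rV[R]_d -> R).

Definition dotv x y : R := \sum_i x 0 i * y 0 i.

(* The Euclidean norm; the norm `|x| of the library on 'rV[R]_d is the
   maximum norm. *)
Definition norm2 x : R := Num.sqrt (\sum_i x 0 i ^+ 2).

Record integration_lattice L : Prop := IntegrationLattice {
  lattice0 : L 0 ;
  latticeB : forall x y, L x -> L y -> L (x - y) ;
  lattice_discrete : L `<=` isolated L ;
  lattice_int : forall z : 'rV[int]_d, L (map_mx intr z) }.

Definition unit_cube : set 'rV[R]_d := [set x | forall i, 0 <= x 0 i < 1].

Definition lattice_points L : set 'rV[R]_d := L `&` unit_cube.

Definition hyperplane u (s : R) : set 'rV[R]_d := [set x | dotv u x = s].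

(* delta is the distance between two adjacent members of some family of
   parallel hyperplanes covering L: u is the common unit normal vector, S the
   set of offsets of the family.  Nothing is assumed on S: if the offsets of
   the points of L are dense then S has no adjacent members, and superfluous
   offsets only split gaps. *)
Definition covering_gap L (delta : R) : Prop :=
  exists u (S : set R) (s t : R),
    [/\ norm2 u = 1, L `<=` \bigcup_(r in S) hyperplane u r,
        [/\ S s, S t & s < t], (forall r, S r -> ~~ (s < r < t)) &
        delta = t - s].

Definition spectral_test L : R := sup [set delta | covering_gap L delta].

Definition dist x A : R := inf [set norm2 (x - y) | y in A].

(* The L_gamma (quasi-)norm over the unit cube, for 0 < gamma <= +oo; the value
   at gamma = -oo is irrelevant.  For gamma = +oo it is the supremum over the
   cube, which agrees with the essential supremum when g is continuous. *)
Definition cube_Lnorm (gamma : \bar R) g : \bar R :=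
  match gamma with
  | r%:E => (\int[lebesgue_tuple R d]_(t in
                [set t | unit_cube (\row_i tnth t i)])
               (`|g (\row_i tnth t i)| `^ r)%:E) `^ r^-1
  | +oo => ereal_sup [set `|g x|%:E | x in unit_cube]
  | -oo => 0
  end%E.

End lattices.

(* Main.v *)
Require Import Defs.
From mathcomp Require Import all_boot all_order all_algebra.
From mathcomp Require Import all_classical all_reals all_analysis.
From mathcomp Require Import measurable_realfun complex ring lra zify.
Import Order.TTheory GRing.Theory Num.Theory.
Import numFieldNormedType.Exports.
Local Open Scope classical_set_scope.
Local Open Scope ring_scope.

(** Write [sigma] for the spectral test of [L], and call an integer vector [h] an
annihilator of [L] when [h . x] is an integer for all [x] in [L].  A nonzero
annihilator gives a covering family of hyperplanes with gap [1 / |h|]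
([annihilator_gap]).  In the other direction, when a family with unit normal [u]
has a gap [delta], the group [u . L] is [delta]-separated ([gap_separated]).

Lower bound, with [c = 1/4].  A point at distance less than [delta / 4] from [L] has
[u . x] at distance less than [delta / 4] from [u . L].  Since the unit vectors belong
to [L], translating a coordinate [x_i] with [u_i <> 0] by [delta / (2 |u_i|)] modulo 1
moves [u . x] to the middle between the points of [u . L].  So the set of points
of the cube near [L] is disjoint from one of its translates modulo 1, and has measure
at most 1/2 ([near_lattice_measure]).  On the remaining part of the cube, of measure
at least 1/2, the distance is at least [delta / 4]; this gives the factor
[2^(1/gamma)].

Upper bound, with [C = 4 d^3].  It is a transference theorem: if [L] has no nonzero
annihilator with coordinates at most [n] in absolute value, then each point of the
space is within about [1 / n] of [L].  It is proved by a positive kernel.  Let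
[A(t) = \sum_k sin (pi k / (n+1)) e^(2 i pi k t)], for [k] from 1 to [n], and
[K(y) = \prod_i |A(y_i)|^2].  For every coordinate [j], the function
[K(y) (cos (2 pi y_j) - cos (pi / (n+1)))] is a trigonometric polynomial whose
frequencies are nonzero and bounded by [n] ([sum_kernel_cos]).  Its sum over the
points [x + g], for [g] in [L] modulo integers, therefore vanishes by orthogonality of
characters.  As [K >= 0], some [y = x + g] satisfies
[\sum_j cos (2 pi y_j) >= d cos (pi / (n+1))] ([exists_sum_cos_ge]), which forces all
the coordinates of [y] to be within [d / (n+1)] of integers
([annihilator_covering]).  Choosing [n] of order [1 / (d sigma)] bounds the covering
radius, and moving [x] inside the cube beforehand makes sure that the lattice point
found lies in the cube ([dist_lattice_points_le]). *)

Set Implicit Arguments.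
Unset Strict Implicit.

(** * Lattices as discrete groups *)
Section lattice_group.
Context (R : realType) (d : nat).
Implicit Types (x y u : 'rV[R]_d) (L : set 'rV[R]_d).

Lemma latticeN L x : integration_lattice L -> L x -> L (- x).
Proof. by move=> lL Lx; rewrite -sub0r; apply: latticeB => //; exact: lattice0. Qed.

Lemma latticeD L x y : integration_lattice L -> L x -> L y -> L (x + y).
Proof. by move=> lL Lx Ly; rewrite -(opprK y); apply: latticeB => //; exact: latticeN. Qed.

Lemma lattice_mulrn L x k : integration_lattice L -> L x -> L (x *+ k).
Proof.
move=> lL Lx; elim: k => [|k IH]; first by rewrite mulr0n; exact: lattice0.
by rewrite mulrS; exact: latticeD.
Qed.

Definition floorv x : 'rV[int]_d := \row_i Num.floor (x 0 i).

Definition fracv x : 'rV[R]_d := x - map_mx intr (floorv x).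

Lemma fracv_unit_cube x : unit_cube (fracv x).
Proof.
move=> i; rewrite !mxE; have := floor_itv (x 0 i).
by rewrite intrD subr_ge0 ltrBlDl.
Qed.

Lemma fracv_lattice_points L x :
  integration_lattice L -> L x -> lattice_points L (fracv x).
Proof.
move=> lL Lx; split; last exact: fracv_unit_cube.
by apply: latticeB => //; exact: lattice_int.
Qed.

Lemma lattice_points0 L : integration_lattice L -> lattice_points L 0.
Proof.
move=> lL; split; first exact: lattice0.
by move=> i; rewrite mxE lexx ltr01.
Qed.

Lemma unit_cube_eq x y (z : 'rV[int]_d) :
  unit_cube x -> unit_cube y -> x - y = map_mx intr z -> x = y.
Proof.
move=> cx cy xyz; apply/rowP => i.
have := congr1 (fun M : 'rV_d => M 0 i) xyz; rewrite !mxE => zi.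
have /andP[x0 x1] := cx i; have /andP[y0 y1] := cy i.
suff z0 : z 0 i = 0 by apply/eqP; rewrite -subr_eq0 zi z0.
have h1 : -1%:~R < (z 0 i)%:~R :> R by rewrite -zi; lra.
have h2 : (z 0 i)%:~R < 1%:~R :> R by rewrite -zi; lra.
move: h1 h2; rewrite -intrN !ltr_int => h1 h2.
by apply/eqP; lia.
Qed.

(** Discreteness is uniform: an isolating neighbourhood of the origin, moved by
the group, isolates every point. *)
Lemma lattice_separated L : integration_lattice L ->
  exists2 e : R, 0 < e & forall y, L y -> (forall i, `|y 0 i| < e) -> y = 0.
Proof.
move=> lL; have [_ [V V0 VL]] := lattice_discrete lL (lattice0 lL).
have /nbhs_ballP[e /= e0 eV] := V0; exists e => // y Ly ye.
have : (V `&` L) y.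
  split=> //; apply: eV; split=> // i j; rewrite ord1 mxE /ball /= sub0r normrN.
  exact: ye.
by rewrite VL.
Qed.

(** Cutting the cube into cells of side less than the separation of the lattice
leaves at most one lattice point in each cell. *)
Lemma finite_lattice_points L :
  integration_lattice L -> finite_set (lattice_points L).
Proof.
move=> lL; have [e e0 eL] := lattice_separated lL.
pose k := Num.truncn e^-1; have ke : e^-1 < k.+1%:R by rewrite truncnS_gt.
have k0 : 0 < k.+1%:R :> R by rewrite ltr0n.
have cell x i : unit_cube x -> (Num.truncn (k.+1%:R * x 0 i)%R < k.+1)%N.
  move=> /(_ i)/andP[x0 x1]; rewrite truncn_lt_nat ?mulr_ge0 ?ler0n//.
  by rewrite -[ltRHS]mulr1 ltr_pM2l.
pose f x : {ffun 'I_d -> 'I_k.+1} :=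
  [ffun i => inord (Num.truncn (k.+1%:R * x 0 i))].
have fI : {in lattice_points L &, injective f}.
  move=> x y /set_mem[Lx cx] /set_mem[Ly cy] fxy.
  apply/eqP; rewrite -subr_eq0; apply/eqP; apply: eL.
    exact: latticeB.
  move=> i; rewrite !mxE.
  have := congr1 (fun g : {ffun _ -> _} => val (g i)) fxy.
  rewrite !ffunE /= !inordK ?cell// => fi.
  have /andP[x0 x1] := cx i; have /andP[y0 y1] := cy i.
  have /andP[a1 a2] := truncn_itv (mulr_ge0 (ltW k0) x0).
  have /andP[b1 b2] := truncn_itv (mulr_ge0 (ltW k0) y0).
  rewrite fi in a1 a2.
  have : k.+1%:R * `|x 0 i - y 0 i| < 1.
    rewrite -(gtr0_norm k0) -normrM mulrBr ltr_norml.
    set t := Num.truncn _ in a1 a2 b1 b2.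
    by rewrite -[t.+1%:R]natr1 in a2 b2; apply/andP; split; lra.
  rewrite mulrC -ltr_pdivlMr// mul1r => /lt_trans; apply.
  by rewrite invf_plt ?posrE.
by rewrite -(eq_finite_set (inj_card_eq fI)); exact: finite_finset.
Qed.

End lattice_group.

(** * Euclidean norm and distance to a set *)
Section euclid.
Context (R : realType) (d : nat).
Implicit Types (x y u : 'rV[R]_d) (A : set 'rV[R]_d).

Lemma dotvD u x y : dotv u (x + y) = dotv u x + dotv u y.
Proof. by rewrite /dotv -big_split; apply: eq_bigr => i _; rewrite mxE mulrDr. Qed.

Lemma dotvN u x : dotv u (- x) = - dotv u x.
Proof. by rewrite /dotv -sumrN; apply: eq_bigr => i _; rewrite mxE mulrN. Qed.

Lemma dotvB u x y : dotv u (x - y) = dotv u x - dotv u y.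
Proof. by rewrite dotvD dotvN. Qed.

Lemma dotv_mulz u x (k : int) : dotv u (x *~ k) = dotv u x *~ k.
Proof.
rewrite -mulrzr mulr_suml; apply: eq_bigr => i _.
by rewrite -scaler_int mxE; ring.
Qed.

Lemma dotvZ (a : R) u x : dotv (a *: u) x = a * dotv u x.
Proof. by rewrite /dotv mulr_sumr; apply: eq_bigr => i _; rewrite mxE mulrA. Qed.

Lemma dotvZr (a : R) u x : dotv u (a *: x) = a * dotv u x.
Proof. by rewrite /dotv mulr_sumr; apply: eq_bigr => i _; rewrite mxE mulrCA. Qed.

Lemma dotv_delta u i : dotv u (delta_mx 0 i) = u 0 i.
Proof.
rewrite /dotv (bigD1 i)//= big1 ?addr0.
  by rewrite mxE !eqxx mulr1.
by move=> j ji; rewrite mxE eqxx (negPf ji) mulr0.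
Qed.

Lemma norm2_ge0 x : 0 <= norm2 x.
Proof. exact: sqrtr_ge0. Qed.

Lemma sqr_norm2 x : norm2 x ^+ 2 = \sum_i x 0 i ^+ 2.
Proof. by rewrite sqr_sqrtr// sumr_ge0// => i _; exact: sqr_ge0. Qed.

Lemma coord_le_norm2 x i : `|x 0 i| <= norm2 x.
Proof.
rewrite -ler_sqr ?nnegrE ?norm2_ge0// sqr_norm2 (bigD1 i)//= real_normK ?num_real//.
by rewrite lerDl sumr_ge0// => j _; exact: sqr_ge0.
Qed.

Lemma norm2_le x (M : R) : 0 <= M -> (forall i, `|x 0 i| <= M) -> norm2 x <= d%:R * M.
Proof.
move=> M0 xM; rewrite -ler_sqr ?nnegrE ?norm2_ge0 ?mulr_ge0// sqr_norm2.
apply: (@le_trans _ _ (\sum_(i < d) M ^+ 2)).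
  by apply: ler_sum => i _; rewrite -[x 0 i ^+ 2]real_normK ?num_real// ler_sqr ?nnegrE.
rewrite sumr_const card_ord exprMn -[leLHS]mulr_natl ler_wpM2r ?exprn_ge0//.
by rewrite -natrX ler_nat; case: d => // k; rewrite expnS expn1 leq_pmulr.
Qed.

Lemma norm2_eq0 x : norm2 x = 0 -> x = 0.
Proof.
move=> x0; apply/rowP => i; apply/eqP; rewrite mxE -normr_le0 -x0.
exact: coord_le_norm2.
Qed.

Lemma norm2_int_gt0 (h : 'rV[int]_d) :
  h != 0 -> 0 < norm2 (map_mx intr h : 'rV[R]_d).
Proof.
move=> h0; rewrite lt_neqAle norm2_ge0 andbT eq_sym.
apply: contra_neq h0 => /norm2_eq0 hh; apply/rowP => i.
have := congr1 (fun M : 'rV[R]_d => M 0 i) hh; rewrite !mxE => /eqP.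
by rewrite intr_eq0 => /eqP.
Qed.

(** Cauchy-Schwarz, read off from the square of the norm of the component of [x]
orthogonal to [u]. *)
Lemma dotv_le_norm2 u x : norm2 u = 1 -> `|dotv u x| <= norm2 x.
Proof.
move=> u1; rewrite -ler_sqr ?nnegrE ?norm2_ge0// real_normK ?num_real// sqr_norm2.
set t := dotv u x; have tE : t = \sum_i u 0 i * x 0 i by [].
have : 0 <= \sum_i (x 0 i - t * u 0 i) ^+ 2 by apply: sumr_ge0 => i _; exact: sqr_ge0.
rewrite (_ : \sum_i _ = \sum_i x 0 i ^+ 2 - 2 * t * t + t ^+ 2 * norm2 u ^+ 2).
  by rewrite u1; nra.
have -> : 2 * t * t = \sum_i 2 * t * (u 0 i * x 0 i) by rewrite -mulr_sumr.
rewrite sqr_norm2 mulr_sumr -sumrB -big_split/=.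
by apply: eq_bigr => i _; ring.
Qed.

Lemma norm2Z (a : R) x : norm2 (a *: x) = `|a| * norm2 x.
Proof.
rewrite /norm2 -sqrtr_sqr -sqrtrM ?sqr_ge0// mulr_sumr; congr Num.sqrt.
by apply: eq_bigr => i _; rewrite mxE exprMn.
Qed.

Lemma dist_le x y A : A y -> dist x A <= norm2 (x - y).
Proof.
move=> Ay; apply: ge_inf; last by exists y.
by exists 0 => _ [z _ <-]; exact: norm2_ge0.
Qed.

Lemma dist_ge0 x A : 0 <= dist x A.
Proof.
have [->|/set0P[y Ay]] := eqVneq A set0; first by rewrite /dist image_set0 inf0.
apply: lb_le_inf; first by exists (norm2 (x - y)), y.
by move=> _ [z _ <-]; exact: norm2_ge0.
Qed.

Lemma le_dist x A (r : R) : A !=set0 -> (forall y, A y -> r <= norm2 (x - y)) ->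
  r <= dist x A.
Proof.
move=> [y Ay] rA; apply: lb_le_inf; first by exists (norm2 (x - y)), y.
by move=> _ [z Az <-]; exact: rA.
Qed.

End euclid.

(** * Complex exponentials *)
Section exponential.
Context (R : realType).
Local Open Scope complex_scope.

Definition cis (t : R) : R[i] := cos (2 * pi * t) +i* sin (2 * pi * t).

Lemma cis0 : cis 0 = 1.
Proof. by rewrite /cis mulr0 cos0 sin0. Qed.

Lemma cisD s t : cis (s + t) = cis s * cis t.
Proof. by rewrite /cis mulrDr cosD sinD; congr (_ +i* _); ring. Qed.

Lemma cisN t : cis (- t) = conjc (cis t).
Proof. by rewrite /cis mulrN cosN sinN. Qed.

Lemma cis_neq0 t : cis t != 0.
Proof.
apply/eqP => t0; have /esym/eqP := cisD t (- t).
by rewrite subrr cis0 t0 mul0r eq_sym oner_eq0.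
Qed.

Lemma cisNV t : cis (- t) = (cis t)^-1.
Proof.
apply: (mulfI (cis_neq0 t)); rewrite -cisD subrr cis0 divff//.
exact: cis_neq0.
Qed.

Lemma cis_muln (n : nat) t : cis (n%:R * t) = cis t ^+ n.
Proof.
elim: n => [|n IH]; first by rewrite mul0r cis0 expr0.
by rewrite -natr1 mulrDl mul1r cisD IH exprSr.
Qed.

Lemma cis_mulz (k : int) t : cis (k%:~R * t) = cis t ^ k.
Proof.
case: k => n; first by rewrite -pmulrn cis_muln.
by rewrite NegzE intrN mulNr cisNV cis_muln.
Qed.

Lemma cis_int (t : R) : t \is a Num.int -> cis t = 1.
Proof.
move=> /intrP[k ->]; rewrite -[k%:~R]mulr1 cis_mulz.
rewrite (_ : cis 1 = 1) ?exp1rz//.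
by rewrite /cis mulr1 mulr_natl cos2pi sin2pi.
Qed.

Lemma cis_eq1 (t : R) : cis t = 1 -> t \is a Num.int.
Proof.
move=> t1; have /andP[f0 f1] := floor_itv t.
set w := t - (Num.floor t)%:~R.
have w1 : cis w = 1 by rewrite cisD t1 mul1r -intrN cis_int.
have w0 : 0 <= w by rewrite subr_ge0.
have wlt1 : w < 1 by rewrite ltrBlDl; rewrite intrD in f1.
have [w_eq0|w_neq0] := eqVneq w 0.
  by rewrite -(subrK (Num.floor t)%:~R t) -/w w_eq0 add0r.
have wgt0 : 0 < w by rewrite lt_neqAle eq_sym w_neq0.
have s0 : 0 < sin (pi * w).
  by rewrite sin_gt0_pi// mulr_gt0 ?pi_gt0//= -[ltRHS]mulr1 ltr_pM2l ?pi_gt0.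
move: w1 => [+ _].
rewrite (_ : 2 * pi * w = (pi * w) *+ 2); last by ring.
rewrite cos_mulr2n cos2sin2 => h.
have := exprn_gt0 2 s0; lra.
Qed.

Lemma cis_sum (I : Type) (r : seq I) (F : I -> R) :
  cis (\sum_(i <- r) F i) = \prod_(i <- r) cis (F i).
Proof. exact: (big_morph cis cisD cis0). Qed.

(** Summation by parts: where the weights satisfy [s (k+2) + s k = 2 c s (k+1)],
multiplication by [z + 1/z - 2 c] cancels every inner coefficient of the
polynomial and only the two ends of the range survive.  With [s k] a sine and
[z] on the unit circle this is the identity behind the kernel below. *)
Lemma second_difference_sum (F : fieldType) (z c : F) (s : nat -> F) (m : nat) :
  z != 0 -> s 0%N = 0 -> (forall k, s k.+2 + s k = 2 * c * s k.+1) ->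
  (z + z^-1 - 2 * c) * (\sum_(k < m.+1) s k * z ^+ k) =
  s 1%N + s m * z ^+ m.+1 - s m.+1 * z ^+ m.
Proof.
move=> z0 s0 rec; elim: m => [|m IH].
  by rewrite big_ord_recl big_ord0 s0; ring.
rewrite big_ord_recr /= mulrDr IH.
rewrite (_ : s m.+2 = 2 * c * s m.+1 - s m); last by rewrite -rec addrK.
by rewrite !exprS; field.
Qed.

End exponential.

(** * Sums over the lattice points of the cube *)
Section lattice_sums.
Context (R : realType) (d : nat) (L : set 'rV[R]_d) (s : seq 'rV[R]_d).
Hypothesis lL : integration_lattice L.
Hypothesis us : uniq s.
Hypothesis sE : lattice_points L = [set` s].

(** The points of the cube represent the quotient of [L] by the integer vectors,
so translating by an element of [L] permutes them modulo integers. *)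
Lemma sum_lattice_shift (V : nmodType) (f : 'rV[R]_d -> V) (g0 : 'rV[R]_d) :
  (forall y (z : 'rV[int]_d), f (y - map_mx intr z) = f y) -> L g0 ->
  \sum_(g <- s) f (g + g0) = \sum_(g <- s) f g.
Proof.
move=> fper Lg0; pose t g := fracv (g + g0).
have sP g : g \in s <-> lattice_points L g by rewrite sE.
have ut : uniq (map t s).
  rewrite map_inj_in_uniq// => x y /sP[_ cx] /sP[_ cy] txy.
  apply: (@unit_cube_eq _ _ x y (floorv (x + g0) - floorv (y + g0))) => //.
  apply/rowP => i; have := congr1 (fun M : 'rV_d => M 0 i) txy.
  by rewrite !mxE rmorphB/=; lra.
have sub : {subset map t s <= s}.
  move=> _ /mapP[g /sP[Lg _] ->]; apply/sP.
  exact: fracv_lattice_points lL (latticeD lL Lg Lg0).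
have pts : perm_eq (map t s) s.
  by apply: uniq_perm => //; have [] := uniq_min_size ut sub; rewrite ?size_map.
rewrite -[RHS](perm_big _ pts) big_map.
by apply: eq_bigr => g _; rewrite /t /fracv fper.
Qed.

Definition annihilates (h : 'rV[int]_d) :=
  forall y, L y -> dotv (map_mx intr h) y \is a Num.int.

(** Translating by a vector [g0] with [h . g0] not an integer multiplies the sum
by a scalar different from 1. *)
Lemma character_sum (h : 'rV[int]_d) (x : 'rV[R]_d) :
  ~ annihilates h ->
  \sum_(g <- s) cis (dotv (map_mx intr h) (x + g)) = 0.
Proof.
move=> /existsNP[g0 /not_implyP[Lg0 hg0]].
set S := \sum_(g <- s) _.
have : S = cis (dotv (map_mx intr h) g0) * S.
  rewrite {1}/S -(@sum_lattice_shift _ _ g0)//.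
    rewrite mulr_sumr; apply: eq_bigr => g _.
    by rewrite addrA !dotvD !cisD mulrC.
  move=> y z; rewrite addrA (dotvD _ (x + y)) cisD [X in _ * X]cis_int ?mulr1//.
  rewrite dotvN rpredN /dotv; apply: rpred_sum => i _; rewrite !mxE.
  by rewrite rpredM ?intr_int.
move=> /eqP; rewrite -subr_eq0 -{1}[S]mul1r -mulrBl mulf_eq0 subr_eq0.
move=> /orP[/eqP/esym/cis_eq1//|/eqP//].
Qed.

(** Averaging a product of one-variable trigonometric polynomials over a shifted
lattice keeps the constant term only, as soon as no nonzero annihilator of [L]
occurs among its frequencies.  The coefficients [a i] and the frequencies [k i]
are indexed by an arbitrary finite type, so that products of polynomials can be
used without collecting equal frequencies. *)
Lemma trigonometric_sum (I : finType) (x : 'rV[R]_d)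
    (a : 'I_d -> I -> R[i]) (k : 'I_d -> I -> int) :
  (forall h, h != 0 -> annihilates h ->
     exists i, forall p, a i p != 0 -> k i p != h 0 i) ->
  \sum_(g <- s) \prod_i \sum_p a i p * cis ((k i p)%:~R * (x + g) 0 i) =
  (size s)%:R * \prod_i \sum_(p | k i p == 0) a i p.
Proof.
move=> hyp.
rewrite (eq_bigr _ (fun g _ => bigA_distr_bigA
  (fun i p => a i p * cis ((k i p)%:~R * (x + g) 0 i)))).
rewrite exchange_big/= bigA_distr_big_dep mulr_sumr [RHS]big_mkcond/=.
apply: eq_bigr => f _; pose h : 'rV[int]_d := \row_i k i (f i).
transitivity ((\prod_i a i (f i)) *
              \sum_(g <- s) cis (dotv (map_mx intr h) (x + g))).
  rewrite mulr_sumr; apply: eq_bigr => g _; rewrite big_split/=; congr (_ * _).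
  by rewrite cis_sum; apply: eq_bigr => i _; rewrite !mxE.
case: ifPn => [/familyP f0|nf0].
  have h0 : h = 0 by apply/rowP => i; rewrite !mxE; exact/eqP/f0.
  rewrite mulrC; congr (_ * _).
  rewrite h0 (eq_bigr (fun=> 1)); last first.
    move=> g _; rewrite /dotv big1 ?cis0// => i _.
    by rewrite !mxE mul0r.
  by rewrite big_const_seq count_predT iter_addr_0.
have h0 : h != 0.
  apply: contra nf0 => /eqP h0; apply/familyP => i.
  by apply/eqP; have := congr1 (fun M : 'rV_d => M 0 i) h0; rewrite !mxE => ->.
have [hL|hL] := pselect (annihilates h); last first.
  by rewrite (character_sum x hL) mulr0.
have [i ai] := hyp h h0 hL.
rewrite (bigD1 i)//= (_ : a i (f i) = 0) ?mul0r//.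
apply/eqP/negPn/negP => /ai; by rewrite mxE eqxx.
Qed.

End lattice_sums.

(** * The Fejer-Korovkin kernel *)
Section korovkin_kernel.
Context (R : realType) (n : nat).
Hypothesis n0 : (0 < n)%N.

Let theta : R := pi / n.+1%:R.

(** These weights are the Dirichlet eigenvector of the discrete Laplacian on
[1 .. n]; they vanish at [0] and at [n + 1].  Among the trigonometric polynomials
of this length, the squared modulus of the one with these coefficients has its
mass most concentrated at the integers, in the sense of the mean of the cosine,
which is [cos (pi / (n + 1))]. *)
Definition sine_weight (k : nat) : R := sin (k%:R * theta).

Definition korovkin (t : R) : R[i] :=
  \sum_(k < n.+1) (real_complex R (sine_weight k)) * cis t ^+ k.

Lemma sine_weight0 : sine_weight 0 = 0.
Proof. by rewrite /sine_weight mul0r sin0. Qed.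

Lemma sine_weight_last : sine_weight n.+1 = 0.
Proof. by rewrite /sine_weight mulrC divfK ?pnatr_eq0// sinpi. Qed.

Lemma sine_weight1_gt0 : 0 < sine_weight 1.
Proof.
rewrite /sine_weight mul1r sin_gt0_pi// divr_gt0 ?pi_gt0 ?ltr0n//=.
by rewrite ltr_pdivrMr ?ltr0n// ltr_pMr ?pi_gt0// ltr1n.
Qed.

Lemma sine_weight_rec k :
  sine_weight k.+2 + sine_weight k = 2 * cos theta * sine_weight k.+1.
Proof.
rewrite /sine_weight (_ : k.+2%:R * theta = k.+1%:R * theta + theta); last first.
  by rewrite -(natr1 k.+1) mulrDl mul1r.
rewrite (_ : k%:R * theta = k.+1%:R * theta - theta); last first.
  by rewrite -(natr1 k) mulrDl mul1r addrK.
by rewrite sinD sinB; ring.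
Qed.

Lemma cis_sum_inv (t : R) :
  cis t + (cis t)^-1 = real_complex R (2 * cos (2 * pi * t)).
Proof.
by rewrite -cisNV cisN /cis; apply/eqP; rewrite eq_complex/= subrr; apply/andP;
  split => //; apply/eqP; ring.
Qed.

(** The Laplacian acts on frequencies as multiplication by a cosine; the
eigenvector equation fails only at the two boundary frequencies, 0 and [n + 1]. *)
Lemma korovkin_difference (t : R) :
  real_complex R (2 * cos (2 * pi * t) - 2 * cos theta) * korovkin t =
  real_complex R (sine_weight 1) +
  real_complex R (sine_weight n) * cis t ^+ n.+1.
Proof.
have := @second_difference_sum _ (cis t) (real_complex R (cos theta))
  (fun k => real_complex R (sine_weight k)) n (cis_neq0 t).
rewrite sine_weight0 sine_weight_last => /(_ erefl) H.
rewrite rmorphB/= -cis_sum_inv rmorphM rmorph_nat/= H ?mul0r ?subr0// => k.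
by rewrite -rmorphD sine_weight_rec !rmorphM rmorph_nat.
Qed.

Lemma conj_korovkin (t : R) :
  conjc (korovkin t) =
  \sum_(k < n.+1) (real_complex R (sine_weight k)) * cis (- k%:R * t).
Proof.
rewrite /korovkin rmorph_sum; apply: eq_bigr => k _.
rewrite rmorphM; congr (_ * _).
  by rewrite /= oppr0.
transitivity (conjc (cis t) ^+ k); first exact: rmorphXn.
by rewrite -cisN mulNr -mulrN cis_muln.
Qed.

End korovkin_kernel.

Section kernel_products.
Context (R : realType) (n : nat).
Local Notation rc := (real_complex R).
Local Notation A := (@korovkin R n).

(** The index [k] runs up to [n + 1], one further than in the kernel, so that the
same expansion serves the kernel and its boundary polynomial. *)
Lemma mul_conj_korovkin (c : nat -> R) (t : R) :
  (\sum_(k < n.+2) rc (c k) * cis t ^+ k) * conjc (A t) =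
  \sum_(p : 'I_n.+2 * 'I_n.+1) rc (c p.1 * sine_weight R n p.2) *
     cis ((p.1%:Z - p.2%:Z)%:~R * t).
Proof.
rewrite conj_korovkin big_distrlr pair_big; apply: eq_bigr => -[k l] _ /=.
rewrite rmorphM mulrACA; congr (_ * _).
by rewrite rmorphB/= mulrBl cisD mulNr -!pmulrn cis_muln.
Qed.

Lemma korovkinE (t : R) :
  A t = \sum_(k < n.+2) rc (sine_weight R n k) * cis t ^+ k.
Proof. by rewrite [RHS]big_ord_recr/= sine_weight_last mul0r addr0. Qed.

Definition boundary_weight (k : nat) : R :=
  if k == 0 then sine_weight R n 1 else if k == n.+1 then sine_weight R n n else 0.

Lemma korovkin_boundary (t : R) :
  rc (2 * cos (2 * pi * t) - 2 * cos (pi / n.+1%:R)) * A t =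
  \sum_(k < n.+2) rc (boundary_weight k) * cis t ^+ k.
Proof.
rewrite korovkin_difference big_ord_recl big_ord_recr /= big1 ?add0r.
  by rewrite expr0 mulr1 /boundary_weight /= eqxx.
by move=> k _; rewrite /boundary_weight /= /bump /= add1n eqSS ltn_eqF// mul0r.
Qed.

Definition sqr_korovkin (t : R) : R := complex.Re (A t) ^+ 2 + complex.Im (A t) ^+ 2.

Lemma sqr_korovkinE t : rc (sqr_korovkin t) = A t * conjc (A t).
Proof.
rewrite /sqr_korovkin; case: (A t) => a b /=.
by apply/eqP; rewrite eq_complex/=; apply/andP; split; apply/eqP; ring.
Qed.

Lemma sqr_korovkin_ge0 t : 0 <= sqr_korovkin t.
Proof. by rewrite addr_ge0 ?sqr_ge0. Qed.

Lemma sqr_korovkin_eq0 t : sqr_korovkin t = 0 -> A t = 0.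
Proof.
move=> t0; have := sqr_korovkinE t; rewrite t0.
move=> /esym/eqP; rewrite mulf_eq0 conjc_eq0 orbb => /eqP//.
Qed.

End kernel_products.

(** * Averages of the product kernel over the lattice *)
Section covering.
Context (R : realType) (d n : nat) (L : set 'rV[R]_d) (s : seq 'rV[R]_d).
Hypothesis n0 : (0 < n)%N.
Hypothesis lL : integration_lattice L.
Hypothesis us : uniq s.
Hypothesis sE : lattice_points L = [set` s].
Hypothesis dualL : forall h : 'rV[int]_d, h != 0 -> annihilates L h ->
  exists i, n%:Z < `|h 0 i|.
Local Notation rc := (real_complex R).
Local Notation A := (@korovkin R n).
Local Notation K := (@sqr_korovkin R n).

(** In the coordinate [j] the factor [cos - cos (pi / (n + 1))] turns one of the two
factors of [K = A * conj A] into its boundary polynomial, with frequencies 0 and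
[n + 1]; the frequencies of [A] lie strictly between, and are subtracted.  All the
frequencies of the product are thus nonzero in the coordinate [j] and at most [n]
in absolute value, so none of them annihilates [L]. *)
Lemma sum_kernel_cos (x : 'rV[R]_d) (j : 'I_d) :
  \sum_(g <- s) (\prod_i K ((x + g) 0 i)) *
     (cos (2 * pi * (x + g) 0 j) - cos (pi / n.+1%:R)) = 0.
Proof.
pose c i := if i == j then boundary_weight R n else sine_weight R n.
have := trigonometric_sum (s := s) (I := ('I_n.+2 * 'I_n.+1)%type) lL us sE x
   (a := fun i p => rc (c i p.1 * sine_weight R n p.2))
   (k := fun i p => p.1%:Z - p.2%:Z).
move=> H; apply: (mulfI (_ : 2 != 0)) => //; rewrite mulr0; apply: (@complexI R).
rewrite mulr_sumr rmorph_sum/=; rewrite [RHS](_ : _ = 0)// -[RHS](mulr0 (size s)%:R).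
rewrite -[X in _ = _ * X](_ : \prod_i \sum_(p : 'I_n.+2 * 'I_n.+1 |
    p.1%:Z - p.2%:Z == 0) rc (c i p.1 * sine_weight R n p.2) = 0); last first.
  rewrite (bigD1 j)//= big1 ?mul0r// => -[k l]/=.
  rewrite subr_eq0 eqz_nat => /eqP kl; rewrite /c eqxx kl /boundary_weight.
  have [->|_] := eqVneq; first by rewrite sine_weight0 mulr0.
  by rewrite ltn_eqF ?mul0r.
rewrite -H; last first.
  move=> h h0 /(dualL h0)[i hi]; exists i => -[k l] /= cp.
  apply: contraTN hi => /eqP <-; rewrite -leNgt.
  have l0 : nat_of_ord l != 0%N.
    by apply: contraNneq cp => ->; rewrite sine_weight0 mulr0.
  (* For [i = j] the two values [k = 0] and [k = n + 1] remain possible. *)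
  have kn : (i != j) ==> ((nat_of_ord k != 0%N) && (nat_of_ord k != n.+1)).
    apply/implyP => ij; move: cp; rewrite /c (negPf ij) => cp.
    apply/andP; split; apply: contraNneq cp => ->.
      by rewrite sine_weight0 mul0r.
    by rewrite sine_weight_last mul0r.
  have := ltn_ord k; have := ltn_ord l.
  lia.
apply: eq_bigr => g _; set y := x + g.
rewrite (bigD1 j)//= [RHS](bigD1 j)//=; set P := \prod_(i | i != j) K _.
transitivity (rc ((2 * cos (2 * pi * y 0 j) - 2 * cos (pi / n.+1%:R)) *
    K (y 0 j) * P)); first by congr (rc _); ring.
rewrite rmorphM/=; congr (_ * _).
  by rewrite /c eqxx -mul_conj_korovkin -korovkin_boundary -[RHS]mulrA -sqr_korovkinE
             -rmorphM.
rewrite rmorph_prod; apply: eq_bigr => i ij; rewrite /c (negPf ij).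
by rewrite -mul_conj_korovkin -korovkinE -sqr_korovkinE.
Qed.

(** The coefficient of [\prod_i A] at the frequency (1, ..., 1) is a power of
[sin (pi / (n + 1))] and can be recovered by averaging over the lattice; hence this
product is not zero at all the points of a shifted lattice. *)
Lemma exists_kernel_gt0 (x : 'rV[R]_d) :
  exists2 g, g \in s & 0 < \prod_i K ((x + g) 0 i).
Proof.
apply: contrapT => /forall2NP sK.
have A0 g : g \in s -> \prod_i A ((x + g) 0 i) = 0.
  move=> gs; have [//|/negP] := sK g.
  rewrite lt_neqAle prodr_ge0 ?andbT; last by move=> i _; exact: sqr_korovkin_ge0.
  rewrite negbK eq_sym => /prodf_eq0[i _ /eqP/sqr_korovkin_eq0 Ai].
  by rewrite (bigD1 i)//= Ai mul0r.
have := trigonometric_sum (s := s) (I := 'I_n.+1) lL us sE x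
   (a := fun i p => rc (sine_weight R n p)) (k := fun i p => p%:Z - 1).
rewrite big_seq big1; last first.
  move=> g gs; have := A0 g gs.
  move=> /(congr1 (fun z => z * \prod_i cis (- (x + g) 0 i))).
  rewrite mul0r -big_split/= => E; rewrite -[RHS]E.
  apply: eq_bigr => i _; rewrite mulr_suml; apply: eq_bigr => k _.
  by rewrite rmorphB/= mulrBl mul1r cisD mulrA -pmulrn cis_muln.
move=> H; have : 0 = (size s)%:R * \prod_(i < d) rc (sine_weight R n 1).
  rewrite H.
    congr (_ * _); apply: eq_bigr => i _.
    rewrite (big_pred1 (Ordinal (n0 : (1 < n.+1)%N)))//= => k /=.
    by rewrite subr_eq0 eqz_nat.
  move=> h h0 /(dualL h0)[i hi]; exists i => k /= cp.
  apply: contraTN hi => /eqP <-; rewrite -leNgt.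
  have := ltn_ord k; lia.
move/esym/eqP; rewrite mulf_eq0 pnatr_eq0 size_eq0 => /orP[/eqP s0|].
  by have := lattice_points0 lL; rewrite sE s0.
move=> /prodf_eq0[i _ /eqP/complexI s10].
by have := sine_weight1_gt0 R n0; rewrite s10 ltxx.
Qed.

(** The weighted mean of [\sum_j cos (2 pi y_j)] over the shifted lattice, with the
nonnegative weights [\prod_i K], is [d cos (pi / (n + 1))], so
some point reaches at least this value. *)
Lemma exists_sum_cos_ge (x : 'rV[R]_d) : exists2 g, L g &
  d%:R * cos (pi / n.+1%:R) <= \sum_j cos (2 * pi * (x + g) 0 j) :> R.
Proof.
apply: contrapT => /forall2NP sK.
have [g gs Kg] := exists_kernel_gt0 x.
pose F g := \sum_j (cos (2 * pi * (x + g) 0 j) - cos (pi / n.+1%:R)) : R.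
have F0 y : y \in s -> F y < 0.
  move=> ys; have : lattice_points L y by rewrite sE.
  move=> [Ly _]; have [//|/negP] := sK y; rewrite -ltNge.
  by rewrite /F sumrB sumr_const card_ord (mulr_natl _ d) subr_lt0.
have : \sum_(y <- s) (\prod_i K ((x + y) 0 i)) * F y = 0.
  rewrite /F; under eq_bigr do rewrite mulr_sumr.
  by rewrite exchange_big/= big1// => j _; exact: sum_kernel_cos.
apply/eqP; rewrite lt_eqF// (perm_big _ (perm_to_rem gs)) big_cons.
rewrite -[ltRHS]addr0 ltr_leD//; first by rewrite pmulr_rlt0// F0.
rewrite big_seq; apply: sumr_le0 => y /mem_rem ys; apply: mulr_ge0_le0.
  by apply: prodr_ge0 => i _; exact: sqr_korovkin_ge0.
exact/ltW/F0.
Qed.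

End covering.

(** * From a large cosine to a nearby integer *)
Section nearest_integer.
Context (R : realType).
Implicit Types x : R.

Lemma sin_mvt x : 0 < x -> exists2 c, 0 < c < x & sin x = cos c * x.
Proof.
move=> x0; have [|c] := @MVT R sin cos 0 x x0 (fun y _ => is_derive_sin y).
  exact/continuous_subspaceT/continuous_sin.
by rewrite in_itv/= sin0 !subr0; exists c.
Qed.

Lemma sin_le_id x : 0 <= x -> sin x <= x.
Proof.
rewrite le_eqVlt => /predU1P[<-|x0]; first by rewrite sin0.
have [c _ ->] := sin_mvt x0.
by rewrite -[leRHS]mul1r ler_pM2r// cos_le1.
Qed.

Lemma mul_cos_le_sin x : 0 <= x <= pi -> x * cos x <= sin x.
Proof.
rewrite le_eqVlt => /andP[/predU1P[<- _|x0 xpi]]; first by rewrite mul0r sin0.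
have [c /andP[c0 cx] ->] := sin_mvt x0.
rewrite mulrC ler_pM2r// ltW// ltr_cos// in_itv/= ?(ltW x0)//.
by rewrite (ltW c0)/= (le_trans (ltW cx)).
Qed.

(** Halving the angle turns [y cos y <= sin y] into
[sin (2 y) >= 2 y cos^2 y = y (1 + cos (2 y)) >= y]. *)
Lemma half_le_sin x : 0 <= x <= pi / 2 -> x / 2 <= sin x.
Proof.
move=> /andP[x0 xpi]; set y := x / 2; have pi0 := pi_gt0 R.
have y0 : 0 <= y by rewrite divr_ge0.
have cosx : 0 <= cos x by apply: cos_ge0_pihalf; rewrite xpi andbT; lra.
have xE : x = y *+ 2 by rewrite /y -mulr_natr divfK.
have cosy : 0 <= cos y.
  by apply: cos_ge0_pihalf; apply/andP; split; rewrite /y; lra.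
have siny : y * cos y <= sin y.
  by apply: mul_cos_le_sin; rewrite y0/=; rewrite /y; lra.
rewrite xE sin_mulr2n; rewrite xE cos_mulr2n in cosx.
have : y * cos y * cos y <= sin y * cos y by exact: ler_wpM2r.
have := mulr_ge0 y0 cosx; nra.
Qed.

Lemma one_sub_cos x : 1 - cos (2 * x) = 2 * sin x ^+ 2.
Proof. by rewrite mulr_natl cos_mulr2n cos2sin2; ring. Qed.

(** With [w] the offset of [z] from the nearest integer, the hypothesis says
[sin^2 (pi |w|) <= D sin^2 (pi / (2 N))].  The bound [sqrt D / N] that follows is
weakened to [D / N]. *)
Lemma near_integer (D N z : R) : 1 <= D -> 1 <= N ->
  1 - cos (2 * pi * z) <= D * (1 - cos (pi / N)) ->
  exists m : int, `|z - m%:~R| <= D / N.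
Proof.
move=> D1 N1 zD; have N0 : 0 < N := lt_le_trans ltr01 N1.
exists (Num.floor (z + 2^-1)); set m := Num.floor _.
have pi0 := pi_gt0 R.
have /andP[m1 m2] := floor_itv (z + 2^-1); rewrite -/m intrD in m1 m2.
set w := z - m%:~R.
have cosw : cos (2 * pi * z) = cos (2 * pi * `|w|).
  have : cis z = cis w by rewrite cisD -intrN [cis _%:~R]cis_int ?mulr1.
  by move=> [-> _]; case: (ger0P w) => // _; rewrite mulrN cosN.
have w2 : `|w| <= 2^-1 by rewrite ler_norml /w; apply/andP; split; lra.
have h1 : 1 - cos (2 * pi * z) = 2 * sin (pi * `|w|) ^+ 2.
  by rewrite cosw -mulrA one_sub_cos.
have h2 : 1 - cos (pi / N) = 2 * sin (pi / N / 2) ^+ 2.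
  by rewrite -one_sub_cos [2 * _]mulrC divfK.
have s1 : pi * `|w| / 2 <= sin (pi * `|w|).
  by apply: half_le_sin; rewrite mulr_ge0 ?(ltW pi0)//= ler_pM2l.
have b0 : 0 <= pi / N / 2 by rewrite !divr_ge0// ltW.
have bpi : pi / N / 2 <= pi.
  rewrite -mulrA ler_piMr ?(ltW pi0)// -invfM invf_le1; last by rewrite mulr_gt0.
  by lra.
have s2 : sin (pi / N / 2) ^+ 2 <= (pi / N / 2) ^+ 2.
  by rewrite ler_sqr ?nnegrE ?sin_le_id// sin_ge0_pi// b0 bpi.
have s3 : (pi * `|w| / 2) ^+ 2 <= sin (pi * `|w|) ^+ 2.
  by rewrite ler_sqr ?nnegrE// ?(le_trans _ s1)// divr_ge0// mulr_ge0 ?(ltW pi0).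
have s4 : (pi * `|w| / 2) ^+ 2 <= D * (pi / N / 2) ^+ 2.
  apply: le_trans s3 _; apply: le_trans (ler_wpM2l _ s2); last by lra.
  by rewrite h1 h2 in zD; lra.
have wN : `|w| ^+ 2 <= D / N ^+ 2.
  rewrite -(ler_pM2l (_ : 0 < pi ^+ 2 / 4)) ?divr_gt0 ?exprn_gt0//.
  by move: s4; congr (_ <= _); field; rewrite ?gt_eqF.
have D0 : 0 <= D := le_trans ler01 D1.
rewrite -ler_sqr ?nnegrE ?divr_ge0 ?(ltW N0)//.
apply: le_trans wN _; rewrite expr_div_n; apply: ler_wpM2r.
  by rewrite invr_ge0 exprn_ge0// ltW.
by rewrite ler_eXnr.
Qed.

End nearest_integer.

(** * Gaps between hyperplanes and annihilators *)
Section gaps.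
Context (R : realType) (d : nat) (L : set 'rV[R]_d).
Hypothesis lL : integration_lattice L.

Lemma lattice_mulz (x : 'rV[R]_d) (k : int) : L x -> L (x *~ k).
Proof.
move=> Lx; case: k => n; first exact: lattice_mulrn.
by rewrite NegzE mulrNz; apply: latticeN => //; exact: lattice_mulrn.
Qed.

Lemma lattice_delta i : L (delta_mx 0 i).
Proof.
rewrite (_ : delta_mx 0 i = map_mx intr (delta_mx 0 i : 'rV[int]_d)).
  exact: lattice_int.
by apply/rowP => j; rewrite !mxE; case: (_ && _).
Qed.

(** The values [u . x], for [x] in [L], form a subgroup of the reals that avoids the
open interval between the two offsets.  A positive element smaller than the length
of that interval would have a multiple inside it. *)
Lemma gap_separated (delta : R) : covering_gap L delta ->
  exists u, [/\ norm2 u = 1, 0 < delta &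
    forall x, L x -> dotv u x != 0 -> delta <= `|dotv u x|].
Proof.
move=> [u [S [s [t [u1 LS [Ss St st] Sst ->]]]]]; exists u; split => //.
  by rewrite subr_gt0.
suff pos x : L x -> 0 < dotv u x -> t - s <= dotv u x.
  move=> x Lx ux0; case: (ger0P (dotv u x)) => ux.
    by apply: pos; rewrite // lt_neqAle eq_sym ux0.
  rewrite -dotvN; apply: pos; first exact: latticeN.
  by rewrite dotvN oppr_gt0.
move=> Lx; set p := dotv u x => p0; rewrite leNgt; apply/negP => pst.
have /andP[f1 f2] := floor_itv (s / p); set k := Num.floor (s / p) + 1 in f2.
have : S (p * k%:~R).
  have [r Sr] := LS _ (lattice_mulz k Lx).
  by rewrite /hyperplane/= dotv_mulz -mulrzr => ->.
move=> /Sst/negP; apply; rewrite ltr_pdivrMr// in f2; rewrite ler_pdivlMr// in f1.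
rewrite mulrC f2/= /k intrD mulrDl mul1r; lra.
Qed.

(** The coordinates of [u] are values of [u . x] at the unit vectors, which belong
to [L]. *)
Lemma gap_le_coord (u : 'rV[R]_d) (delta : R) :
  (forall x, L x -> dotv u x != 0 -> delta <= `|dotv u x|) ->
  forall i, u 0 i != 0 -> delta <= `|u 0 i|.
Proof.
move=> sep i ui; rewrite -dotv_delta; apply: sep; first exact: lattice_delta.
by rewrite dotv_delta.
Qed.

Lemma unit_coord_neq0 (u : 'rV[R]_d) : norm2 u = 1 -> exists i, u 0 i != 0.
Proof.
move=> u1; apply: contrapT => /forallNP u0.
suff : u = 0.
  move=> u0'; move: u1; rewrite u0' /norm2 big1 ?sqrtr0 => [/eqP|i _].
    by rewrite eq_sym oner_eq0.
  by rewrite mxE expr0n.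
by apply/rowP => i; rewrite mxE; apply/eqP/negPn/negP/u0.
Qed.

Lemma gap_le1 (delta : R) : covering_gap L delta -> delta <= 1.
Proof.
move=> /gap_separated[u [u1 d0 sep]]; have [i ui] := unit_coord_neq0 u1.
by apply: le_trans (gap_le_coord sep ui) _; rewrite -u1 coord_le_norm2.
Qed.

Lemma gap_le_spectral_test (delta : R) :
  covering_gap L delta -> delta <= spectral_test L.
Proof.
move=> gd; apply: ub_le_sup => //.
by exists 1 => e /gap_le1.
Qed.

(** The hyperplanes on which [h . x] is an integer cover [L]; two adjacent ones are
at distance [1 / |h|]. *)
Lemma annihilator_gap (h : 'rV[int]_d) : h != 0 -> annihilates L h ->
  covering_gap L (norm2 (map_mx intr h : 'rV[R]_d))^-1.
Proof.
move=> h0 hL; set N := norm2 _.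
have Ngt0 : 0 < N := norm2_int_gt0 R h0.
exists (N^-1 *: map_mx intr h), [set r | exists k : int, r = k%:~R / N], 0, N^-1; split.
- by rewrite norm2Z -/N ger0_norm ?invr_ge0 ?(ltW Ngt0)// mulVf ?gt_eqF.
- move=> x Lx; have /intrP[k hx] := hL _ Lx.
  exists (k%:~R / N); first by exists k.
  by rewrite /hyperplane/= dotvZ hx mulrC.
- split; [by exists 0; rewrite mul0r|by exists 1; rewrite mul1r|by rewrite invr_gt0].
- move=> _ [k ->]; rewrite pmulr_lgt0 ?invr_gt0// ltr0z.
  apply/negP => /andP[k0]; rewrite -ltr_pdivlMr ?invr_gt0// divff ?invr_eq0 ?gt_eqF//.
  by rewrite (ltr_int _ _ 1); lia.
- by rewrite subr0.
Qed.

End gaps.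

(** * The covering radius *)
Section covering_radius.
Context (R : realType) (d : nat) (L : set 'rV[R]_d).
Hypothesis d0 : (0 < d)%N.
Hypothesis lL : integration_lattice L.

Let dR0 : 0 < d%:R :> R. Proof. by rewrite ltr0n. Qed.
Let dR1 : 1 <= d%:R :> R. Proof. by rewrite ler1n. Qed.

(** A point where all the cosines are close to 1 on average is close to an integer
vector in each coordinate, because each single cosine is at most 1. *)
Lemma annihilator_covering (n : nat) : (0 < n)%N ->
  (forall h : 'rV[int]_d, h != 0 -> annihilates L h ->
     exists i, n%:Z < `|h 0 i|) ->
  forall x : 'rV[R]_d, exists2 y, L y & forall i, `|x 0 i - y 0 i| <= d%:R / n.+1%:R.
Proof.
move=> n0 dualL x; have /finite_seqP[s0 s0E] := finite_lattice_points lL.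
pose s := undup s0; have us : uniq s := undup_uniq s0.
have sE : lattice_points L = [set` s].
  by rewrite s0E; apply/seteqP; split=> y /=; rewrite mem_undup.
have [g Lg gx] := exists_sum_cos_ge n0 lL us sE dualL x.
have near j : exists m : int, `|(x + g) 0 j - m%:~R| <= d%:R / n.+1%:R.
  apply: near_integer; rewrite ?ler1n//.
  have le1 i : cos (2 * pi * (x + g) 0 i) <= 1 by exact: cos_le1.
  rewrite (bigD1 j)//= in gx.
  have : \sum_(i < d | i != j) cos (2 * pi * (x + g) 0 i) <= d%:R - 1.
    apply: (@le_trans _ _ (\sum_(i < d | i != j) 1)); first exact: ler_sum.
    by rewrite sumr_const cardC1 card_ord -[d in _ <= d%:R - 1](prednK d0) -natr1 addrK.
  by lra.
have [m mP] := choice near.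
exists (map_mx intr (\row_i m i) - g).
  by apply: latticeB => //; exact: lattice_int.
by move=> i; have := mP i; rewrite !mxE; congr (`|_| <= _); ring.
Qed.

(** Without annihilators the previous lemma would apply for all [n] and make [L]
dense.  In particular the spectral test is positive. *)
Lemma exists_annihilator : exists2 h : 'rV[int]_d, h != 0 & annihilates L h.
Proof.
apply: contrapT => /forall2NP noh; have [e e0 eL] := lattice_separated lL.
pose n := (Num.truncn (2 * d%:R / e)).+1.
have ne : d%:R / n.+1%:R < e / 2.
  rewrite ltr_pdivrMr ?ltr0n// -ltr_pdivrMl ?divr_gt0//.
  apply: (@lt_trans _ _ n%:R); last by rewrite ltr_nat.
  apply: le_lt_trans (truncnS_gt _); rewrite le_eqVlt; apply/orP; left.
  by apply/eqP; field; rewrite gt_eqF.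
have [//|h h0 hL|y Ly ye] := @annihilator_covering n _ _ (const_mx (e / 2)).
  by have [/(_ h0)|/(_ hL)] := noh h.
have ye' i : 0 < y 0 i < e.
  have := le_lt_trans (ye i) ne; rewrite mxE ltr_norml => /andP[h1 h2].
  by apply/andP; split; lra.
have y0 : y = 0.
  apply: eL => // i; have /andP[y0 ylt] := ye' i.
  by rewrite gtr0_norm.
by have := ye' (Ordinal d0); rewrite y0 mxE ltxx.
Qed.

Lemma inv_norm2_le_spectral_test (h : 'rV[int]_d) : h != 0 -> annihilates L h ->
  (norm2 (map_mx intr h : 'rV[R]_d))^-1 <= spectral_test L.
Proof. by move=> h0 hL; apply: gap_le_spectral_test => //; exact: annihilator_gap. Qed.

Lemma spectral_test_gt0 : 0 < spectral_test L.
Proof.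
have [h h0 hL] := exists_annihilator.
by apply: lt_le_trans (inv_norm2_le_spectral_test h0 hL); rewrite invr_gt0 norm2_int_gt0.
Qed.

(** Annihilators have Euclidean norm at least [1 / sigma], hence some coordinate at
least [1 / (d sigma)]; the previous covering lemma applies with [n + 1] the integer
part of [1 / (d sigma)], which is at least half of that number. *)
Lemma covering_radius_lt (x : 'rV[R]_d) : d%:R * spectral_test L <= 2^-1 ->
  exists2 y, L y & forall i, `|x 0 i - y 0 i| < 2 * d%:R ^+ 2 * spectral_test L.
Proof.
have := spectral_test_gt0; set sg := spectral_test L => s0 ds.
have ds0 : 0 < d%:R * sg by rewrite mulr_gt0.
have := truncn_itv (ltW (_ : 0 < (d%:R * sg)^-1)); rewrite invr_gt0 => /(_ ds0).
have : (2 <= Num.truncn (d%:R * sg)^-1)%N.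
  by rewrite truncn_ge_nat ?invr_ge0 ?(ltW ds0)// -[leLHS]invrK lef_pV2 ?posrE// invr_gt0.
case: (Num.truncn _) => [//|n] n1 /andP[Q1 Q2].
rewrite -div1r ler_pdivlMr// in Q1; rewrite -div1r ltr_pdivrMr// -natr1 in Q2.
have nn : n%:R + 1 = n.+1%:R :> R by rewrite natr1.
have n1R : 1 <= n%:R :> R by rewrite ler1n.
have [//|h h0 hL|y Ly yx] := @annihilator_covering n _ _ x.
  apply: contrapT => /forallNP hn.
  have : norm2 (map_mx intr h : 'rV[R]_d) <= d%:R * n%:R.
    apply: norm2_le => // i; rewrite mxE -intr_norm pmulrn ler_int leNgt.
    exact/negP/hn.
  have := inv_norm2_le_spectral_test h0 hL; rewrite -/sg.
  have N0 := norm2_int_gt0 R h0; rewrite -div1r ler_pdivrMr// => h1 h2.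
  have : sg * norm2 (map_mx intr h : 'rV[R]_d) <= sg * (d%:R * n%:R).
    by rewrite ler_pM2l.
  by rewrite -nn in Q1; nra.
exists y => // i; apply: le_lt_trans (yx i) _.
rewrite ltr_pdivrMr ?ltr0n//.
rewrite (_ : 2 * _ * _ * _ = d%:R * (n.+1%:R * (d%:R * sg) * 2)); last by ring.
rewrite ltr_pMr// -nn in Q1 Q2 *.
have : 0 < n%:R * (d%:R * sg) by rewrite mulr_gt0// ltr0n.
by nra.
Qed.

(** To obtain a lattice point in the cube itself, and not in a translate, the point
[x] is first pushed to a depth [r] inside the cube, where [r] bounds the covering
radius.  When [r] is at least 1/2 there is no room, but then the origin is close
enough. *)
Lemma dist_lattice_points_le (x : 'rV[R]_d) : unit_cube x ->
  dist x (lattice_points L) <= 4 * d%:R ^+ 3 * spectral_test L.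
Proof.
move=> cx; have := spectral_test_gt0; set sg := spectral_test L => s0.
pose r := 2 * d%:R ^+ 2 * sg.
have d2 : 1 <= d%:R ^+ 2 :> R by rewrite exprn_ege1.
have [rbig|rsmall] := leP 2^-1 r.
  apply: (@le_trans _ _ (d%:R * 1)).
    apply: (le_trans (dist_le x (lattice_points0 lL))).
    apply: norm2_le => // i; rewrite !mxE subr0.
    by have /andP[x0 x1] := cx i; rewrite ger0_norm// ltW.
  rewrite (_ : _ * sg = d%:R * (2 * r)); last by rewrite /r; ring.
  by rewrite ler_pM2l//; lra.
have r0 : 0 < r by rewrite !mulr_gt0 ?exprn_gt0.
have ds : d%:R * sg <= 2^-1.
  have : d%:R * sg <= d%:R ^+ 2 * sg by rewrite ler_pM2r// ler_eXnr.
  by rewrite /r in rsmall; lra.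
(* Depth [r] leaves room for an error below [r] in each coordinate. *)
pose x' : 'rV[R]_d := \row_i Num.min (Num.max (x 0 i) r) (1 - r).
have [y Ly yx] := covering_radius_lt x' ds.
have bnd i : 0 <= y 0 i < 1 /\ `|x 0 i - y 0 i| <= 2 * r.
  have /andP[x0 x1] := cx i; have := yx i; rewrite -/r mxE ltr_norml.
  rewrite ler_norml /Num.min /Num.max.
  case: ifPn; rewrite -?leNgt; case: ifPn; rewrite -?leNgt => a b /andP[u v];
    split; apply/andP; split; lra.
apply: (le_trans (dist_le x (_ : lattice_points L y))).
  by split=> // i; have [] := bnd i.
rewrite (_ : _ * sg = d%:R * (2 * r)); last by rewrite /r; ring.
apply: norm2_le; first by lra.
by move=> i; rewrite !mxE; have [] := bnd i.
Qed.

End covering_radius.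

(** * Sets of measure at most one half *)
Section translation.
Context (R : realType).
Local Notation RT := (measurableTypeR R).
Local Notation lambda := (@lebesgue_measure R).

Lemma measurable_shift (a : R) : measurable_fun [set: RT] (fun x : RT => (x + a : RT)).
Proof. exact: measurable_funD. Qed.

Lemma lebesgue_measure_shift (a : R) (A : set RT) : measurable A ->
  lambda ((fun x : RT => (x + a : RT)) @^-1` A) = lambda A.
Proof.
move=> mA; apply/esym.
pose f x : RT := (x : RT) + a.
have mf : measurable_fun [set: RT] f := measurable_shift a.
pose mu : {measure set RT -> \bar R} :=
  measure_function_pushforward__canonical__measure_function_Measure lambda mf.
apply: (@lebesgue_measure_unique R mu) => // _ [[x y] _ <-]/=.
rewrite /pushforward (_ : _ @^-1` _ = `]x - a, y - a]%classic); last first.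
  by apply/seteqP; split=> z /=; rewrite !in_itv/= ltrBlDr lerBrDr.
by rewrite !lebesgue_measure_itv/= !lte_fin ltrD2r -!EFinB opprB addrA subrK.
Qed.

(** [S] is disjoint from its image [T1 `|` T2] under the translation by [tau] modulo
1, and both are subsets of the unit interval with the same measure. *)
Lemma half_measure_itv (tau : R) (S : set RT) : 0 <= tau <= 1 -> measurable S ->
  S `<=` `[0, 1[ ->
  (forall x y, S x -> S y -> y != x + tau /\ y != x + tau - 1) ->
  (lambda S <= 2^-1%:E)%E.
Proof.
move=> /andP[t0 t1] mS S01 Stau.
pose S1 := S `&` `[0, 1 - tau[; pose S2 := S `&` `[1 - tau, 1[.
have mS1 : measurable S1 by apply: measurableI => //; exact: measurable_itv.
have mS2 : measurable S2 by apply: measurableI => //; exact: measurable_itv.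
pose T1 := (fun x : RT => (x - tau : RT)) @^-1` S1.
pose T2 := (fun x : RT => (x + (1 - tau) : RT)) @^-1` S2.
have mT1 : measurable T1 by rewrite -[T1]setTI; exact: measurable_shift.
have mT2 : measurable T2 by rewrite -[T2]setTI; exact: measurable_shift.
have lT1 : lambda T1 = lambda S1 by exact: lebesgue_measure_shift.
have lT2 : lambda T2 = lambda S2 by exact: lebesgue_measure_shift.
have SE : S = S1 `|` S2.
  rewrite /S1 /S2 -setIUr; apply/esym/setIidPl => x /S01/=.
  rewrite !in_itv/= => /andP[x0 x1]; rewrite x0 x1 !andbT.
  by case: (ltP x (1 - tau)); [left|right].
have lS : lambda S = (lambda S1 + lambda S2)%E.
  rewrite {1}SE measureU// -subset0 => x [[_ /=]]; rewrite in_itv/= => /andP[_ xlt].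
  by move=> [_ /=]; rewrite in_itv/= leNgt xlt.
have T12 : T1 `&` T2 = set0.
  rewrite -subset0 => x [[_ /=]]; rewrite in_itv/= => /andP[x1 _] [_ /=].
  by rewrite in_itv/= => /andP[_]; lra.
have ST : S `&` (T1 `|` T2) = set0.
  rewrite -subset0 => x [Sx [[Sy _]|[Sy _]]].
    by have [/eqP + _] := Stau _ _ Sy Sx; lra.
  by have [_ /eqP +] := Stau _ _ Sy Sx; lra.
have : (lambda (S `|` (T1 `|` T2)) <= lambda `[0%R, 1%R[%classic)%E.
  apply: le_measure; rewrite ?inE//; first by do 2?apply: measurableU.
  move=> x [/S01//|[[_ /=]|[_ /=]]]; rewrite !in_itv/= => /andP[a b];
    apply/andP; split; lra.
rewrite lebesgue_measure_itv/= lte_fin ltr01 oppr0 adde0.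
have lT : lambda (T1 `|` T2) = lambda S by rewrite lS -lT1 -lT2 measureU.
have -> : lambda (S `|` (T1 `|` T2)) = (lambda S + lambda S)%E.
  by rewrite -[X in (_ = _ + X)%E]lT measureU//; exact: measurableU.
move=> le1.
have Sfin : lambda S \is a fin_num.
  rewrite ge0_fin_numE//; apply: le_lt_trans (ltry 1); apply: le_trans le1.
  by rewrite leeDl.
by move: le1; rewrite -(fineK Sfin) -EFinD !lee_fin; lra.
Qed.

End translation.

Section half_measure.
Context (R : realType).
Local Notation RT := (measurableTypeR R).
Local Notation lambda := (@lebesgue_measure R).

Let unit_itv : set RT := `[0%R, 1%R[%classic.

Let mI : measurable unit_itv. Proof. exact: measurable_itv. Qed.

Let lI : lambda unit_itv = 1%E.
Proof. by rewrite /unit_itv lebesgue_measure_itv/= lte_fin ltr01 oppr0 adde0. Qed.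

Definition tuple_cube n : set (n.-tuple RT) := [set t | forall i, unit_itv (tnth t i)].

Lemma measurable_tuple_cube n : measurable (tuple_cube (n := n)).
Proof. exact: (@measurable_tuple_box R n (fun=> unit_itv)) (fun=> measurable_itv _). Qed.

Lemma lebesgue_tuple_cube n : lebesgue_tuple R n (tuple_cube (n := n)) = 1%E.
Proof.
by rewrite (@lebesgue_tuple_box R n (fun=> unit_itv))// big1// => i _; rewrite lI.
Qed.

Lemma half_integral d (T : measurableType d) (mu : {measure set T -> \bar R})
    (A : set T) : measurable A -> mu A = 1%E ->
  (\int[mu]_x (2^-1 * \1_A x)%:E <= 2^-1%:E)%E.
Proof.
move=> mA muA; under eq_integral do rewrite EFinM.
rewrite ge0_integralZl_EFin//; last first.
  - exact/measurable_EFinP.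
  - by rewrite integral_indic// setIT muA mule1.
Qed.

(** Fubini reduces the statement to the lines parallel to the coordinate axis [i],
where it is the one-dimensional case.  Both orders of integration are used: the
inner variable is the first coordinate if that is the axis, and otherwise the tuple
of the other coordinates, to which the induction hypothesis applies. *)
Lemma half_measure n (i : 'I_n) (tau : R) (E : set (n.-tuple RT)) :
  0 <= tau <= 1 -> measurable E -> E `<=` tuple_cube (n := n) ->
  (forall t t', E t -> E t' -> (forall j, j != i -> tnth t j = tnth t' j) ->
     tnth t' i != tnth t i + tau /\ tnth t' i != tnth t i + tau - 1) ->
  (lebesgue_tuple R n E <= 2^-1%:E)%E.
Proof.
move=> tau01; elim: n i E => [[]//|n IH] i E mE Ecube Etau.
pose mu := lebesgue_tuple R n.
pose F : set (RT * n.-tuple RT) := @cons_pair R n @^-1` E.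
have mF : measurable F.
  by rewrite -[F]setTI; exact: (@measurable_cons_pair R n).
have mcube := @measurable_tuple_cube n.
change (lebesgue_tuple R n.+1 E) with ((lambda \x mu)%E F).
have Fcube x t : F (x, t) -> unit_itv x /\ tuple_cube t.
  move=> /Ecube Et; split; first exact: (Et ord0).
  by move=> j; have := Et (lift ord0 j); rewrite /cons_pair tnthS.
case: (unliftP ord0 i) => [j|] iE.
  apply: (@le_trans _ _ (\int[lambda]_x (2^-1 * \1_unit_itv x)%:E)%E).
    apply: ge0_le_integral => //.
    - exact: measurable_fun_xsection.
    - apply/measurable_EFinP/measurable_funM => //; exact: measurable_indic.
    move=> x _ /=; have [x01|x01] := pselect (unit_itv x); last first.
      rewrite (_ : xsection F x = set0) ?measure0 ?lee_fin ?mulr_ge0//.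
      by rewrite -subset0 => t; rewrite xsectionP => /Fcube[].
    rewrite indicE mem_set// mulr1; apply: (IH j).
    - exact: measurable_xsection.
    - by move=> t; rewrite xsectionP => /Fcube[].
    move=> t t'; rewrite !xsectionP => Et Et' tt'.
    have := Etau _ _ Et Et'; rewrite iE /cons_pair !tnthS; apply => k ki.
    case: (unliftP ord0 k) => [l|] kE; rewrite kE ?tnthS ?tnth0//; apply: tt'.
    by apply: contraNneq ki => <-; rewrite kE.
  exact: half_integral mI lI.
rewrite (@product_measure_unique _ _ _ _ _ _ _ (lambda \x^ mu)%E)//; last first.
  by move=> A B mA mB; exact: product_measure2E.
apply: (@le_trans _ _ (\int[mu]_t (2^-1 * \1_(tuple_cube (n := n)) t)%:E)%E).
  apply: ge0_le_integral => //.
  - exact: measurable_fun_ysection.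
  - apply/measurable_EFinP/measurable_funM => //; exact: measurable_indic.
  move=> t _ /=; have [t01|t01] := pselect (tuple_cube t); last first.
    rewrite (_ : ysection F t = set0) ?measure0 ?lee_fin ?mulr_ge0//.
    by rewrite -subset0 => x; rewrite ysectionP => /Fcube[].
  rewrite indicE mem_set// mulr1; apply: (half_measure_itv tau01).
  - exact: measurable_ysection.
  - by move=> x; rewrite ysectionP => /Fcube[].
  move=> x y; rewrite !ysectionP => Ex Ey.
  have := Etau _ _ Ex Ey; rewrite iE /cons_pair !tnth0; apply => k ki.
  by case: (unliftP ord0 k) ki => [l|] -> => [_|]; rewrite ?eqxx// !tnthS.
exact: half_integral mcube (lebesgue_tuple_cube n).
Qed.

End half_measure.

(** * The distance function on the cube *)
Section distance_function.
Context (R : realType) (d : nat) (L : set 'rV[R]_d).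
Hypothesis lL : integration_lattice L.
Local Notation RT := (measurableTypeR R).
Local Notation mu := (lebesgue_tuple R d).
Local Notation D t := (dist (\row_i tnth (t : d.-tuple RT) i) (lattice_points L)).

Lemma tuple_cubeE :
  [set t : d.-tuple RT | unit_cube (\row_i tnth t i : 'rV[R]_d)] = tuple_cube (n := d).
Proof.
by apply/seteqP; split=> t /= tc i; have := tc i; rewrite ?mxE /= in_itv.
Qed.

Lemma measurable_norm2_sub (y : 'rV[R]_d) :
  measurable_fun setT (fun t : d.-tuple RT => norm2 (\row_i tnth t i - y) : R).
Proof.
rewrite /norm2; apply: (@measurableT_comp _ _ _ _ _ _ (@Num.sqrt R)).
  by apply: continuous_measurable_fun; exact: sqrt_continuous.
apply: measurable_sum => i; apply: measurable_funX.
under eq_fun do rewrite !mxE.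
by apply: measurable_funB => //; exact: measurable_tnth.
Qed.

(** Numbering the finite point set turns the distance into the infimum of a sequence
of measurable functions; beyond the end of the list the sequence repeats the
distance to the origin, which is itself a lattice point. *)
Lemma measurable_dist : measurable_fun setT (fun t : d.-tuple RT => D t : R).
Proof.
have /finite_seqP[s sE] := finite_lattice_points lL.
have s0 : 0 \in s by have := lattice_points0 lL; rewrite sE.
pose h k (t : d.-tuple RT) : R := norm2 (\row_i tnth t i - nth 0 s k).
rewrite (_ : (fun _ => _) = fun t => infs (h ^~ t) 0); last first.
  apply/funext => t; rewrite /dist /infs sE; congr inf; apply/seteqP; split.
    by move=> _ [y /= ys <-]; exists (index y s) => //=; rewrite /h nth_index.
  move=> _ [k _ <-]; exists (nth 0 s k) => //=.
  have [ks|sk] := ltnP k (size s); first exact: mem_nth.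
  by rewrite nth_default.
apply: measurable_fun_infs => [t _|k]; last exact: measurable_norm2_sub.
by exists 0 => _ [k _ <-]; exact: norm2_ge0.
Qed.

Lemma measurable_dist_powR (r : R) :
  measurable_fun setT (fun t : d.-tuple RT => `|D t| `^ r : R).
Proof.
apply: (@measurableT_comp _ _ _ _ _ _ (fun x : R => x `^ r)).
  exact: measurable_powR.
by apply: measurableT_comp => //; exact: measurable_dist.
Qed.

Lemma measurable_dist_lt (r : R) : measurable [set t : d.-tuple RT | D t < r].
Proof.
rewrite -[X in measurable X]setTI (_ : [set t | _] = (fun t => D t) @^-1` `]-oo, r[).
  exact: measurable_dist.
by apply/seteqP; split=> t /=; rewrite in_itv.
Qed.

(** If [x] is at distance less than [delta / 4] from [L] then [u . x] is that close to
the [delta]-separated group [u . L].  Moving [x] by [tau] along a coordinate axis,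
modulo 1, changes [u . x] by [delta / 2] modulo [u . L], so such a move never leads
from one of these points to another. *)
Lemma near_lattice_measure (delta : R) : covering_gap L delta ->
  (mu (tuple_cube (n := d) `&` [set t | (D t < delta / 4)%R]) <= 2^-1%:E)%E.
Proof.
move=> /(gap_separated lL)[u [u1 d0 sep]]; have [i ui] := unit_coord_neq0 u1.
have ui0 : 0 < `|u 0 i| by rewrite normr_gt0.
have dui := gap_le_coord lL sep ui.
pose tau := delta / (2 * `|u 0 i|).
have tauE : `|u 0 i| * tau = delta / 2 by rewrite /tau; field; rewrite gt_eqF.
apply: (@half_measure R d i tau).
- apply/andP; split; first by rewrite divr_ge0 ?mulr_ge0// ltW.
  by rewrite /tau ler_pdivrMr ?mulr_gt0// mul1r; lra.
- by apply: measurableI; [exact: measurable_tuple_cube|exact: measurable_dist_lt].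
- by move=> t [].
move=> t t' [_ /= Dt] [_ /= Dt'] tt'.
have close (a : d.-tuple RT) : D a < delta / 4 -> exists2 y, L y &
    `|dotv u (\row_j tnth a j) - dotv u y| < delta / 4.
  move=> Da; apply: contrapT => /forall2NP no; move: Da; apply/negP; rewrite -leNgt.
  apply: le_dist; first by exists 0; exact: lattice_points0.
  move=> y [Ly _]; have [//|/negP] := no y; rewrite -leNgt -dotvB => h.
  by apply: le_trans h _; exact: dotv_le_norm2.
have [y Ly yt] := close _ Dt; have [y' Ly' yt'] := close _ Dt'.
(* The integer [c] is 0 or -1: the translation is taken modulo 1. *)
suff noc (c : int) : tnth t' i <> tnth t i + tau + c%:~R.
  split; apply/eqP => e; [have := noc 0|have := noc (-1)]; apply.
    by rewrite e addr0.
  by rewrite e mulrN1z.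
move=> tic; have rowE : \row_j tnth t' j =
    \row_j tnth t j + (tau + c%:~R) *: delta_mx 0 i :> 'rV[R]_d.
  apply/rowP => j; rewrite !mxE eqxx /=; have [->|ji] := eqVneq j i.
    by rewrite mulr1 tic addrA.
  by rewrite mulr0 addr0 tt'.
pose z := y' - y - (delta_mx 0 i) *~ c.
have Lz : L z.
  apply: (latticeB lL); first exact: (latticeB lL).
  exact: (lattice_mulz lL) (lattice_delta lL i).
have dz : dotv u z = dotv u y' - dotv u y - u 0 i * c%:~R.
  by rewrite /z !dotvB dotv_mulz dotv_delta mulrzr.
have dr : dotv u (\row_j tnth t' j) = dotv u (\row_j tnth t j) + u 0 i * (tau + c%:~R).
  by rewrite rowE dotvD dotvZr dotv_delta mulrC.
have uz : `|dotv u z - u 0 i * tau| < delta / 2.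
  move: yt yt'; rewrite dr dz !ltr_norml => /andP[a1 a2] /andP[b1 b2].
  by apply/andP; split; lra.
have utau : `|u 0 i * tau| = delta / 2.
  by rewrite normrM [`|tau|]gtr0_norm// divr_gt0 ?mulr_gt0.
have z0 : dotv u z != 0.
  by apply: contraTneq uz => ->; rewrite sub0r normrN utau ltxx.
have := sep _ Lz z0; rewrite leNgt => /negP; apply.
rewrite -[dotv u z](subrK (u 0 i * tau)).
by apply: le_lt_trans (ler_normD _ _) _; rewrite utau; lra.
Qed.

Lemma far_lattice_measure (delta : R) : covering_gap L delta ->
  (2^-1%:E <= mu (tuple_cube (n := d) `\` [set t | (D t < delta / 4)%R]))%E.
Proof.
move=> /near_lattice_measure near.
have mC := @measurable_tuple_cube R d; have mF := measurable_dist_lt (delta / 4).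
have aux (a b : \bar R) : (0 <= b -> b <= 2^-1%:E -> 1 = a + b -> 2^-1%:E <= a)%E.
  case: b => [b|//|//]; rewrite !lee_fin => b0 b2.
  by case: a => [a|_|//]; rewrite ?leey// -EFinD => -[ab]; rewrite lee_fin; lra.
apply: (aux _ _ (measure_ge0 _ _) near).
exact: etrans (esym (lebesgue_tuple_cube R d)) (measureDI mu mC mF).
Qed.

Lemma integral_dist_ge (delta r : R) : covering_gap L delta -> 0 < r ->
  (((delta / 4) `^ r / 2)%:E <=
   \int[mu]_(t in tuple_cube (n := d)) (`|D t| `^ r)%:E)%E.
Proof.
move=> gd r0; have [u [_ d0 _]] := gap_separated lL gd.
set G := tuple_cube (n := d) `\` [set t | D t < delta / 4].
have mC := @measurable_tuple_cube R d.
have mG : measurable G by apply: measurableD => //; exact: measurable_dist_lt.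
apply: (@le_trans _ _ (\int[mu]_(t in tuple_cube (n := d))
    ((delta / 4) `^ r * \1_G t)%:E)%E).
  under eq_integral do rewrite EFinM.
  rewrite ge0_integralZl_EFin ?powR_ge0//; last first.
    exact/measurable_EFinP/measurable_indic.
  rewrite integral_indic// EFinM lee_pmul ?lee_fin ?powR_ge0 ?invr_ge0//.
  by rewrite setIidl ?far_lattice_measure// => t [].
have pos t : 0 <= (`|D t| `^ r) by exact: powR_ge0.
apply: ge0_le_integral => //.
- by move=> t _; rewrite lee_fin mulr_ge0 ?powR_ge0.
- by apply/measurable_EFinP/measurable_funM => //; exact: measurable_indic.
- by apply/measurable_EFinP; apply: measurable_funTS; exact: measurable_dist_powR.
move=> t _; rewrite lee_fin indicE.
have [/set_mem[_ /= /negP]|_] := boolP (t \in G); last by rewrite mulr0.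
rewrite -leNgt mulr1 ger0_norm ?dist_ge0// => dD.
by rewrite ge0_ler_powR ?nnegrE ?dist_ge0 ?divr_ge0 ?(ltW r0) ?(ltW d0).
Qed.

End distance_function.

(** * The norms over the cube *)
Section cube_norm.
Context (R : realType) (d : nat) (L : set 'rV[R]_d).
Hypothesis d0 : (0 < d)%N.
Hypothesis lL : integration_lattice L.
Local Notation g := (fun x : 'rV[R]_d => dist x (lattice_points L)).

Lemma powRVK (x r : R) : 0 <= x -> r != 0 -> (x `^ r) `^ r^-1 = x.
Proof. by move=> x0 r0; rewrite -powRrM divff// powRr1. Qed.

Lemma cube_Lnorm_dist_le (gamma : \bar R) : (0 < gamma)%E ->
  (cube_Lnorm gamma g <= (4 * d%:R ^+ 3 * spectral_test L)%:E)%E.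
Proof.
have s0 := spectral_test_gt0 d0 lL; set M := 4 * _ * _.
have M0 : 0 <= M by rewrite !mulr_ge0 ?exprn_ge0// ltW.
case: gamma => [r| |//] r0 /=; last first.
  apply: ge_ereal_sup => _ [x cx <-]; rewrite lee_fin ger0_norm ?dist_ge0//.
  exact: dist_lattice_points_le.
rewrite lte_fin in r0; have rN0 : r != 0 by rewrite gt_eqF.
rewrite -(powRVK M0 rN0) -poweR_EFin; apply: gt0_ler_poweR.
- by rewrite invr_ge0 ltW.
- rewrite in_itv/= leey andbT.
  by apply: integral_ge0 => t _; rewrite lee_fin powR_ge0.
- by rewrite in_itv/= leey lee_fin powR_ge0.
rewrite tuple_cubeE; have mC := @measurable_tuple_cube R d.
apply: (@le_trans _ _ (\int[lebesgue_tuple R d]_(t in tuple_cube (n := d))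
   (M `^ r)%:E)%E); last first.
  by rewrite integral_cst// [X in (_ * X)%E]lebesgue_tuple_cube mule1.
apply: ge0_le_integral => //.
- apply/measurable_EFinP; apply: measurable_funTS; exact: measurable_dist_powR.
move=> t; rewrite -tuple_cubeE => ct; rewrite lee_fin.
rewrite ge0_ler_powR ?nnegrE// ?(ltW r0)// ger0_norm ?dist_ge0//.
exact: dist_lattice_points_le.
Qed.

Lemma cube_Lnorm_dist_ge_gap (gamma : \bar R) (delta : R) : (0 < gamma)%E ->
  covering_gap L delta ->
  ((4^-1 / 2 `^ fine (gamma^-1)%E * delta)%:E <= cube_Lnorm gamma g)%E.
Proof.
move=> g0 gd; have [u [_ dl0 _]] := gap_separated lL gd.
case: gamma g0 => [r| |//] r0.
  rewrite lte_fin in r0; have rN0 : r != 0 by rewrite gt_eqF.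
  rewrite inver (negPf rN0)/= tuple_cubeE.
  rewrite (_ : _ * delta = ((delta / 4) `^ r / 2) `^ r^-1).
    rewrite -poweR_EFin; apply: gt0_ler_poweR.
    + by rewrite invr_ge0 ltW.
    + by rewrite in_itv/= leey lee_fin divr_ge0// powR_ge0.
    + rewrite in_itv/= leey andbT.
      by apply: integral_ge0 => t _; rewrite lee_fin powR_ge0.
    exact: integral_dist_ge.
  rewrite powRM ?powR_ge0// powRVK//; last by rewrite divr_ge0// ltW.
  have -> : 2^-1 `^ r^-1 = (2 `^ r^-1)^-1 :> R.
    have p0 : 2 `^ r^-1 != 0 :> R by rewrite gt_eqF// powR_gt0.
    by apply: (mulfI p0); rewrite divff// -powRM// divff// powR1.
  by ring.
rewrite /= powRr0 divr1.
(* For the supremum, one point of the far set is enough. *)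
have [x cx dx] : exists2 x, unit_cube x & delta / 4 <= g x.
  apply: contrapT => /forall2NP near; have := far_lattice_measure lL gd.
  rewrite (_ : _ `\` _ = set0) ?measure0 ?lee_fin ?invr_le0 ?lern0//.
  rewrite -subset0 -tuple_cubeE => t [/= ct /negP]; rewrite -leNgt => Dt.
  by have [/(_ ct)|/(_ Dt)] := near (\row_i tnth t i).
rewrite (@le_trans _ _ (`|g x|%:E))//.
  by rewrite lee_fin ger0_norm ?dist_ge0// mulrC.
by apply: ereal_sup_ubound; exists x.
Qed.

Lemma cube_Lnorm_dist_ge (gamma : \bar R) : (0 < gamma)%E ->
  ((4^-1 / 2 `^ fine (gamma^-1)%E * spectral_test L)%:E <= cube_Lnorm gamma g)%E.
Proof.
move=> g0; have up := cube_Lnorm_dist_le g0.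
have gap := cube_Lnorm_dist_ge_gap g0.
set c := 4^-1 / _ in gap *; have c0 : 0 < c by rewrite divr_gt0// powR_gt0.
case: (cube_Lnorm gamma g) up gap => [v _ gap| |_ gap]; rewrite ?leey//.
  rewrite lee_fin mulrC -ler_pdivlMr//; apply: ge_sup.
    have [h h0 hL] := exists_annihilator d0 lL.
    by exists (norm2 (map_mx intr h : 'rV[R]_d))^-1; exact: annihilator_gap.
  by move=> delta /gap; rewrite lee_fin ler_pdivlMr// mulrC.
have [h h0 hL] := exists_annihilator d0 lL.
by have := gap _ (annihilator_gap h0 hL).
Qed.

End cube_norm.

Theorem proposition8 (R : realType) (d : nat) (hd : (0 < d)%N) :
  exists c C : R, [/\ 0 < c, c < C &
    forall (L : set 'rV[R]_d) (gamma : \bar R),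
      integration_lattice L -> (0 < gamma)%E ->
      ((c / 2 `^ fine (gamma^-1)%E * spectral_test L)%:E
         <= cube_Lnorm gamma (fun x => dist x (lattice_points L)))%E /\
      (cube_Lnorm gamma (fun x => dist x (lattice_points L))
         <= (C * spectral_test L)%:E)%E].
Proof.
exists 4^-1, (4 * d%:R ^+ 3); split=> [//||L gamma lL g0].
  have : 1 <= d%:R ^+ 3 :> R by rewrite exprn_ege1 ?ler1n.
  by lra.
by split; [exact: cube_Lnorm_dist_ge|exact: cube_Lnorm_dist_le].
Qed.
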